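(* Let $\mathcal H$ and $\mathcal G$ be real Hilbert spaces, let $A\colon\mathcal H\to 2^{\mathcal H}$ and $B\colon\mathcal G\to 2^{\mathcal G}$ be maximally monotone, let $L\colon\mathcal H\to\mathcal G$ be linear and bounded, let $z\in\mathcal H$, and let $r\in\mathcal G$. Consider the primal inclusion $$\text{find } x\in\mathcal H\text{ such that } z\in Ax+L^*B(Lx-r)\qquad\text{(P)}$$ and the dual inclusion $$\text{find } v\in\mathcal G\text{ such that } -r\in -LA^{-1}(z-L^*v)+B^{-1}v.\qquad\text{(D)}$$ Suppose that $L\neq 0$ and that $z\in\operatorname{ran}\big(A+L^*\circ B\circ(L\cdot-r)\big)$. Let $(a_{1,n})_{n\in\mathbb N}$, $(b_{1,n})_{n\in\mathbb N}$, and $(c_{1,n})_{n\in\mathbb N}$ be absolutely summable sequences in $\mathcal H$, and let $(a_{2,n})_{n\in\mathbb N}$, $(b_{2,n})_{n\in\mathbb N}$, and $(c_{2,n})_{n\in\mathbb N}$ be absolutely summable sequences in $\mathcal G$. Furthermore, let $x_0\in\mathcal H$, let $v_0\in\mathcal G$, let $\varepsilon\in\,]0,1/(\|L\|+1)[$, let $(\gamma_n)_{n\in\mathbb N}$ be a sequence in $[\varepsilon,(1-\varepsilon)/\|L\|]$, and set, for every $n\in\mathbb N$, $$\begin{array}{l} y_{1,n}=x_n-\gamma_n(L^*v_n+a_{1,n})\\ y_{2,n}=v_n+\gamma_n(Lx_n+a_{2,n})\\ p_{1,n}=J_{\gamma_nA}(y_{1,n}+\gamma_nz)+b_{1,n}\\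 p_{2,n}=J_{\gamma_nB^{-1}}(y_{2,n}-\gamma_nr)+b_{2,n}\\ q_{1,n}=p_{1,n}-\gamma_n(L^*p_{2,n}+c_{1,n})\\ q_{2,n}=p_{2,n}+\gamma_n(Lp_{1,n}+c_{2,n})\\ x_{n+1}=x_n-y_{1,n}+q_{1,n}\\ v_{n+1}=v_n-y_{2,n}+q_{2,n}. \end{array}$$ Then the following hold for some solution $\overline{x}$ to (P) and some solution $\overline{v}$ to (D) such that $z-L^*\overline{v}\in A\overline{x}$ and $\overline{v}\in B(L\overline{x}-r)$. (i) $x_n-p_{1,n}\to 0$ and $v_n-p_{2,n}\to 0$. (ii) $x_n\rightharpoonup\overline{x}$, $p_{1,n}\rightharpoonup\overline{x}$, $v_n\rightharpoonup\overline{v}$, and $p_{2,n}\rightharpoonup\overline{v}$. (iii) Suppose that $A$ is uniformly monotone at $\overline{x}$. Then $x_n\to\overline{x}$ and $p_{1,n}\to\overline{x}$. (iv) Suppose that $B^{-1}$ is uniformly monotone at $\overline{v}$. Then $v_n\to\overline{v}$ and $p_{2,n}\to\overline{v}$.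
   Context: $\rightharpoonup$ and $\to$ denote weak and strong convergence; a sequence $(a_n)$ is absolutely summable if $\sum_n\|a_n\|<+\infty$. $L^*$ is the adjoint of $L$. For a set-valued operator $M\colon\mathcal H\to 2^{\mathcal H}$: $\operatorname{dom}M=\{x\mid Mx\neq\varnothing\}$, $\operatorname{ran}M=\{u\mid(\exists x)\ u\in Mx\}$, $\operatorname{gra}M=\{(x,u)\mid u\in Mx\}$, $M^{-1}$ is the operator with graph $\{(u,x)\mid u\in Mx\}$, and the resolvent is $J_M=(\operatorname{Id}+M)^{-1}$ (single-valued with full domain when $M$ is maximally monotone). $M$ is monotone if $\langle x-y\mid u-v\rangle\geq 0$ for all $(x,u),(y,v)\in\operatorname{gra}M$, and maximally monotone if no monotone operator has a graph properly containing $\operatorname{gra}M$. Here $A+L^*\circ B\circ(L\cdot-r)$ is the operator $x\mapsto Ax+L^*(B(Lx-r))$. $M$ is uniformly monotone at $x\in\operatorname{dom}M$ if there exists an increasing function $\phi\colon[0,+\infty[\to[0,+\infty]$ that vanishes only at $0$ such that, for every $u\in Mx$ and every $(y,v)\in\operatorname{gra}M$, $\langle x-y\mid u-v\rangle\geq\phi(\|x-y\|)$. *)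

(* Defs.v *)
From HB Require Import structures.
From mathcomp Require Import all_boot all_order all_algebra.
From mathcomp Require Import all_classical all_reals all_analysis.

Set Implicit Arguments.
Unset Strict Implicit.
Unset Printing Implicit Defensive.

Import Order.TTheory GRing.Theory Num.Theory.
Import numFieldNormedType.Exports.

Local Open Scope classical_set_scope.
Local Open Scope ring_scope.

(* {dot V for idfun} is the type of bilinear, symmetric, positive definite
   forms on V. *)
HB.mixin Record NormedModule_isHilbert (R : realType) V
    & NormedModule R V := {
  inner : {dot V for idfun};
  inner_norm : forall x : V, inner x x = `|x| ^+ 2 }.

#[short(type="hilbertType")]
HB.structure Definition Hilbert (R : realType) :=
  {V of CompleteNormedModule R V & NormedModule_isHilbert R V}.

Notation "''[' x , u ]" := (inner x%R u%R) : ring_scope.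

Definition weak_cvg (R : realType) (H : hilbertType R)
    (x : nat -> H) (l : H) : Prop :=
  forall u : H, (fun n => '[x n, u]) @ \oo --> '[l, u].

Definition abs_summable (R : realType) (V : normedModType R)
    (a : nat -> V) : Prop :=
  (\sum_(0 <= n <oo) `|a n|%:E < +oo)%E.

Definition opnorm (R : realType) (V W : normedModType R)
    (L : {linear V -> W}) : R :=
  sup [set `|L x| | x in [set x : V | `|x| <= 1]].

(* Picks the vector L^* v characterized by '[L x, v] = '[x, L^* v];
   it exists and is unique as soon as L is bounded. *)
Definition adjoint (R : realType) (H G : hilbertType R)
    (L : {linear H -> G}) (v : G) : H :=
  xget 0 [set w : H | forall x : H, '[L x, v] = '[x, w]].

(** Set-valued operators from T to 2^U are functions T -> set U. *)

Definition op_dom (T U : Type) (M : T -> set U) : set T :=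
  [set x | M x !=set0].

Definition op_ran (T U : Type) (M : T -> set U) : set U :=
  [set u | exists x, M x u].

Definition op_gra (T U : Type) (M : T -> set U) : set (T * U) :=
  [set xu | M xu.1 xu.2].

Definition op_inv (T U : Type) (M : T -> set U) : U -> set T :=
  fun u => [set x | M x u].

Definition op_scale (R : realType) (H : hilbertType R) (c : R)
    (M : H -> set H) : H -> set H :=
  fun x => [set c *: u | u in M x].

Definition op_id_add (R : realType) (H : hilbertType R)
    (M : H -> set H) : H -> set H :=
  fun x => [set x + u | u in M x].

(* J_M as a function: for M maximally monotone, op_inv (op_id_add M) w is a
   singleton for every w, and this is its element. *)
Definition resolvent (R : realType) (H : hilbertType R)
    (M : H -> set H) (w : H) : H :=
  xget 0 (op_inv (op_id_add M) w).

Definition monotone_op (R : realType) (H : hilbertType R)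
    (M : H -> set H) : Prop :=
  forall x u y v : H, op_gra M (x, u) -> op_gra M (y, v) ->
    0 <= '[x - y, u - v].

Definition maximally_monotone (R : realType) (H : hilbertType R)
    (M : H -> set H) : Prop :=
  monotone_op M /\
  ~ exists N : H -> set H, monotone_op N /\ op_gra M `<` op_gra N.

(* phi matters only on [0, +oo[; "increasing" is non-strict, as it has to be
   for a function that may take the value +oo on a half-line. *)
Definition uniformly_monotone_at (R : realType) (H : hilbertType R)
    (M : H -> set H) (x : H) : Prop :=
  op_dom M x /\
  exists phi : R -> \bar R,
    [/\ (forall t, 0 <= t -> (0 <= phi t)%E),
        (forall s t, 0 <= s -> s <= t -> (phi s <= phi t)%E),
        (forall t, 0 <= t -> (phi t = 0%E <-> t = 0)) &
        forall u y v, M x u -> op_gra M (y, v) ->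
          (phi `|x - y|%R <= ('[x - y, u - v]%R)%:E)%E].

Definition primal_op (R : realType) (H G : hilbertType R)
    (A : H -> set H) (B : G -> set G) (L : {linear H -> G}) (r : G) :
    H -> set H :=
  fun x => [set u + adjoint L v | u in A x & v in B (L x - r)].

Definition primal_solution (R : realType) (H G : hilbertType R)
    (A : H -> set H) (B : G -> set G) (L : {linear H -> G})
    (z : H) (r : G) (x : H) : Prop :=
  primal_op A B L r x z.

Definition dual_solution (R : realType) (H G : hilbertType R)
    (A : H -> set H) (B : G -> set G) (L : {linear H -> G})
    (z : H) (r : G) (v : G) : Prop :=
  [set - L x + y | x in op_inv A (z - adjoint L v) & y in op_inv B v] (- r).

(* Main.v *)
Require Import Defs.
From HB Require Import structures.
From mathcomp Require Import all_boot all_order all_algebra.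
From mathcomp Require Import all_classical all_reals all_analysis.
From mathcomp Require Import ring lra.

(** Stack the two unknowns: in the Hilbert direct sum of [H] and [G] put
    [M (x, v) = (A x - z, B^-1 v + r)] and [S (x, v) = (L^* v, - L x)].  Then
    [M] is maximally monotone, [S] is linear, bounded by the norm of [L] and
    skew, and the points [p] with [- S p] in [M p] are the primal-dual pairs
    that are sought.  The recursion is Tseng's forward-backward-forward method
    for [M + S], perturbed by summable errors.

    An exact step decreases the squared distance to every zero of [M + S] by at
    least [eps] times the square of the norm of [x n - pt n], where [pt n] is
    the point that its backward step reaches ([descent]).  The errors turn this
    into a quasi-Fejer inequality, so the distances to the zeros converge
    ([quasi_Fejer_cvg]), and therefore [x n - pt n] tends to [0].  The points
    [pt n] satisfy [w n - S (pt n)] in [M (pt n)] with [w n] tending to [0]; as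
    [S] is skew, this inclusion passes to weak limits, so all weak cluster points are zeros of [M + S], and Opial's argument
    ([Opial]) gives weak convergence to one of them.

    For strong convergence, add the monotonicity gaps of [A] and of [B^-1]
    between the limit [l] and [pt n].  The terms that involve [L] cancel, and
    the sum is ['[pt n - l, w n]], which tends to [0].  Both gaps are
    nonnegative, so each of them tends to [0], and a modulus of uniform
    monotonicity converts this into norm convergence of its component.

    Two facts about Hilbert spaces are needed on the way: the adjoint exists,
    and resolvents are defined everywhere (Minty's theorem).  Both come from one
    minimization lemma, [epigraph_prox], applied to a linear functional in
    [Riesz_representation] and to the Fitzpatrick function in [Minty].  Bounded
    sequences have weak limits along ultrafilters, again by the representation
    of bounded functionals ([weak_cvg_ultra]); this avoids extracting
    subsequences. *)

Import Order.TTheory GRing.Theory Num.Theory.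
Import numFieldNormedType.Exports.

Local Open Scope classical_set_scope.
Local Open Scope ring_scope.

Set Implicit Arguments.
Unset Strict Implicit.
Unset Printing Implicit Defensive.

(** * Inner products *)

Section inner_theory.
Context (R : realType) (H : hilbertType R).
Implicit Types (x y u : H) (a : R).

Lemma innerC x y : '[x, y] = '[y, x].
Proof. by rewrite (@hermC _ _ _ _ inner) /= expr0 mul1r. Qed.

Lemma innerDl x y u : '[x + y, u] = '[x, u] + '[y, u].
Proof. exact: linearDl. Qed.

Lemma innerNl x u : '[- x, u] = - '[x, u].
Proof. exact: linearNl. Qed.

Lemma innerZl a x u : '[a *: x, u] = a * '[x, u].
Proof. exact: linearZl_LR. Qed.

Lemma inner0l u : '[0 : H, u] = 0 :> R.
Proof. exact: linear0l. Qed.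

Lemma innerDr u x y : '[u, x + y] = '[u, x] + '[u, y].
Proof. exact: linearDr. Qed.

Lemma innerNr u x : '[u, - x] = - '[u, x].
Proof. exact: linearNr. Qed.

Lemma innerZr u a x : '[u, a *: x] = a * '[u, x].
Proof. exact: linearZr_LR. Qed.

Lemma inner0r u : '[u, 0 : H] = 0 :> R.
Proof. exact: linear0r. Qed.

Definition innerE := (innerDl, innerNl, innerZl, inner0l,
  innerDr, innerNr, innerZr, inner0r).

Lemma inner_ge0 x : 0 <= '[x, x].
Proof. by rewrite inner_norm sqr_ge0. Qed.

Lemma inner_eq0 x : '[x, x] = 0 -> x = 0.
Proof. by rewrite inner_norm => /eqP; rewrite sqrf_eq0 normr_eq0 => /eqP. Qed.

(** Positivity of the square of [|y|^2 x - '[x, y] y]. *)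
Lemma abs_inner_le x y : `|'[x, y]| <= `|x| * `|y|.
Proof.
rewrite -ler_sqr ?nnegrE ?mulr_ge0// exprMn real_normK ?num_real//.
rewrite -!inner_norm.
have [/inner_eq0 ->|yy0] := eqVneq '[y, y] 0.
  by rewrite !inner0r expr0n mulr0.
have yy_gt0 : 0 < '[y, y] by rewrite lt_def yy0 inner_ge0.
have := inner_ge0 ('[y, y] *: x - '[x, y] *: y).
rewrite !innerE (innerC y x) => h.
have {h}: 0 <= '[y, y] * ('[x, x] * '[y, y] - '[x, y] ^+ 2).
  by apply: le_trans h _; rewrite le_eqVlt; apply/orP; left; apply/eqP; ring.
by rewrite pmulr_rge0// subr_ge0.
Qed.

Lemma inner_le x y : '[x, y] <= `|x| * `|y|.
Proof. exact: le_trans (ler_norm _) (abs_inner_le x y). Qed.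

Lemma inner_inj x y : (forall u, '[x, u] = '[y, u]) -> x = y.
Proof.
by move=> xy; apply/subr0_eq/inner_eq0; rewrite innerDl innerNl xy subrr.
Qed.

Lemma sqr_normB x y : `|x - y| ^+ 2 = `|x| ^+ 2 - 2 * '[x, y] + `|y| ^+ 2.
Proof. by rewrite -!inner_norm !innerE (innerC y x); ring. Qed.

Section limits.
Context (T : Type) (F : set_system T) {FF : Filter F}.

Lemma cvg_inner (f g : T -> H) l m : f @ F --> l -> g @ F --> m ->
  (fun t => '[f t, g t]) @ F --> '[l, m].
Proof.
move=> fl gm.
have polar (a b : H) : '[a, b] = 4^-1 * (`|a + b| ^+ 2 - `|a - b| ^+ 2).
  by rewrite -!inner_norm !innerE (innerC b a); field.
rewrite polar; under eq_fun do rewrite polar.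
apply: cvgM; first exact: cvg_cst.
by apply: cvgB; rewrite !expr2; apply: cvgM; apply: cvg_norm;
  [exact: cvgD|exact: cvgD|exact: cvgB|exact: cvgB].
Qed.

Lemma cvg_inner0_bounded (f g : T -> H) (C : R) : (forall t, `|f t| <= C) ->
  g @ F --> (0 : H) -> (fun t => '[f t, g t]) @ F --> (0 : R).
Proof.
move=> fC g0; apply/norm_cvg0P.
apply: (@squeeze_cvgr _ _ _ _ (fun=> 0) (fun t => C * `|g t|)).
- apply: nearW => t; rewrite normr_ge0 /=.
  by apply: le_trans (abs_inner_le _ _) _; rewrite ler_wpM2r.
- exact: cvg_cst.
- rewrite -[X in _ --> X](mulr0 C).
  by apply: cvgMr; apply/norm_cvg0P.
Qed.

End limits.
End inner_theory.

(** * The Hilbert direct sum *)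

(** A copy of the product: the norm that the product already carries is the
    maximum of the norms, which is not Hilbertian. *)
Definition hsum (R : realType) (H G : hilbertType R) : Type := (H * G)%type.

HB.instance Definition _ (R : realType) (H G : hilbertType R) :=
  GRing.Lmodule.copy (hsum H G) (H * G)%type.

Section hsum.
Context (R : realType) (H G : hilbertType R).
Implicit Types (p q : hsum H G) (a : R).

Definition hpair (x : H) (v : G) : hsum H G := (x, v).

Definition hfst p : H := p.1.

Definition hsnd p : G := p.2.

Definition hsum_inner p q : R := '[hfst p, hfst q] + '[hsnd p, hsnd q].

Definition hsum_norm p : R := Num.sqrt (hsum_inner p p).

Let sumC p q : hsum_inner p q = hsum_inner q p.
Proof. by rewrite /hsum_inner !(innerC (hfst p), innerC (hsnd p)). Qed.

Let sumP a p p' q :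
  hsum_inner (a *: p + p') q = a * hsum_inner p q + hsum_inner p' q.
Proof. by rewrite /hsum_inner /hfst /hsnd /= !innerE; ring. Qed.

Let sum_bilinear : bilinear_for
  (GRing.Scale.Law.clone _ _ *%R _) (GRing.Scale.Law.clone _ _ (idfun \; *%R) _)
  hsum_inner.
Proof.
split=> q a p p' /=; first exact: sumP.
by rewrite sumC sumP !(sumC q).
Qed.

HB.instance Definition _ := @bilinear_isBilinear.Build R
  (hsum H G) (hsum H G) R _ _ hsum_inner sum_bilinear.

Let sum_hermitian p q :
  hsum_inner p q = (-1) ^+ false * idfun (hsum_inner q p).
Proof. by rewrite expr0 mul1r sumC. Qed.

HB.instance Definition _ := @isHermitianSesquilinear.Build R (hsum H G) false
  idfun hsum_inner sum_hermitian.

Let sum_ge0 p : 0 <= hsum_inner p p.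
Proof. by rewrite addr_ge0 ?inner_ge0. Qed.

Let sum_eq0 p : hsum_inner p p = 0 -> p = 0.
Proof.
case: p => x v /eqP; rewrite paddr_eq0 ?inner_ge0//= => /andP[/eqP + /eqP].
by move=> /inner_eq0 -> /inner_eq0 ->.
Qed.

Let sum_gt0 p : p != 0 -> 0 < hsum_inner p p.
Proof.
move=> p0; rewrite lt_def sum_ge0 andbT.
by apply: contra_neq p0; exact: sum_eq0.
Qed.

HB.instance Definition _ :=
  @isDotProduct.Build R (hsum H G) hsum_inner sum_gt0.

Let sum_normE p : hsum_norm p ^+ 2 = `|hfst p| ^+ 2 + `|hsnd p| ^+ 2.
Proof. by rewrite sqr_sqrtr // -!inner_norm. Qed.

Let sum_normD p q : hsum_norm (p + q) <= hsum_norm p + hsum_norm q.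
Proof.
rewrite -ler_sqr ?nnegrE ?addr_ge0 ?sqrtr_ge0// sqrrD !sum_normE /=.
set a := hsum_norm p; set b := hsum_norm q.
have ab : '[hfst p, hfst q] + '[hsnd p, hsnd q] <= a * b.
  apply: le_trans (lerD (inner_le _ _) (inner_le _ _)) _.
  rewrite -ler_sqr ?nnegrE ?addr_ge0 ?mulr_ge0 ?sqrtr_ge0//.
  rewrite exprMn !sum_normE -subr_ge0.
  suff -> : forall s t s' t' : R,
    (s ^+ 2 + t ^+ 2) * (s' ^+ 2 + t' ^+ 2) - (s * s' + t * t') ^+ 2 =
    (s * t' - t * s') ^+ 2 by exact: sqr_ge0.
  by move=> *; ring.
rewrite -!inner_norm !innerE (innerC (hfst q)) (innerC (hsnd q)).
lra.
Qed.

Let sum_normZ a p : hsum_norm (a *: p) = `|a| * hsum_norm p.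
Proof.
rewrite /hsum_norm /hsum_inner /hfst /hsnd /= !innerE !mulrA -mulrDr -expr2.
by rewrite sqrtrM ?sqr_ge0// sqrtr_sqr.
Qed.

Let sum_norm_eq0 p : hsum_norm p = 0 -> p = 0.
Proof.
by move=> /eqP; rewrite sqrtr_eq0 => p0; apply/sum_eq0/le_anti/andP.
Qed.

HB.instance Definition _ :=
  @Lmodule_isNormed.Build R (hsum H G) hsum_norm
    sum_normD sum_normZ sum_norm_eq0.

Lemma hfstD p q : hfst (p + q) = hfst p + hfst q.
Proof. by []. Qed.

Lemma hfstN p : hfst (- p) = - hfst p.
Proof. by []. Qed.

Lemma hfstZ a p : hfst (a *: p) = a *: hfst p.
Proof. by []. Qed.

Lemma hsndD p q : hsnd (p + q) = hsnd p + hsnd q.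
Proof. by []. Qed.

Lemma hsndN p : hsnd (- p) = - hsnd p.
Proof. by []. Qed.

Lemma hsndZ a p : hsnd (a *: p) = a *: hsnd p.
Proof. by []. Qed.

Lemma hfst_pair x v : hfst (hpair x v) = x.
Proof. by []. Qed.

Lemma hsnd_pair x v : hsnd (hpair x v) = v.
Proof. by []. Qed.

Lemma hsum_ext p q : hfst p = hfst q -> hsnd p = hsnd q -> p = q.
Proof. by case: p q => [? ?] [? ?]; rewrite /hfst /hsnd /= => -> ->. Qed.

Definition hsumE := (hfstD, hfstN, hfstZ, hsndD, hsndN, hsndZ,
  hfst_pair, hsnd_pair).

Lemma hsum_normE p : `|p| ^+ 2 = `|hfst p| ^+ 2 + `|hsnd p| ^+ 2.
Proof. exact: sum_normE. Qed.

Lemma norm_fst_le p : `|hfst p| <= `|p|.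
Proof. by rewrite -ler_sqr ?nnegrE// hsum_normE lerDl sqr_ge0. Qed.

Lemma norm_snd_le p : `|hsnd p| <= `|p|.
Proof. by rewrite -ler_sqr ?nnegrE// hsum_normE lerDr sqr_ge0. Qed.

Lemma hsum_norm_le p : `|p| <= `|hfst p| + `|hsnd p|.
Proof.
rewrite -ler_sqr ?nnegrE ?addr_ge0// hsum_normE sqrrD.
by rewrite lerD2r lerDl mulrn_wge0// mulr_ge0.
Qed.

Section limits.
Context (T : Type) (F : set_system T) {FF : Filter F}.

Lemma cvg_hsum (f : T -> hsum H G) l :
  (fun t => hfst (f t)) @ F --> hfst l ->
  (fun t => hsnd (f t)) @ F --> hsnd l -> f @ F --> l.
Proof.
move=> /cvgrPdist_lt f1 /cvgrPdist_lt f2; apply/cvgrPdist_lt => e e0.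
have e20 : 0 < e / 2 by rewrite divr_gt0.
near=> t; apply: le_lt_trans (hsum_norm_le _) _.
rewrite [ltRHS]splitr ltrD//; [near: t; exact: f1|near: t; exact: f2].
Unshelve. all: by end_near. Qed.

Lemma cvg_hfst (f : T -> hsum H G) l : f @ F --> l ->
  (fun t => hfst (f t)) @ F --> hfst l.
Proof.
move=> /cvgrPdist_lt fl; apply/cvgrPdist_lt => e /fl; apply: filterS => t.
by apply: le_lt_trans; exact: norm_fst_le (l - f t).
Qed.

Lemma cvg_hsnd (f : T -> hsum H G) l : f @ F --> l ->
  (fun t => hsnd (f t)) @ F --> hsnd l.
Proof.
move=> /cvgrPdist_lt fl; apply/cvgrPdist_lt => e /fl; apply: filterS => t.
by apply: le_lt_trans; exact: norm_snd_le (l - f t).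
Qed.

End limits.

Let sum_complete (F : set_system (hsum H G)) :
  ProperFilter F -> cauchy F -> cvg F.
Proof.
move=> FF /cauchyP Fc.
have c1 : cvg ((fun p : hsum H G => hfst p) @ F).
  apply/cauchy_cvgP/cauchyP => e e0; have [p Fp] := Fc e e0; exists (hfst p).
  suff : F (fun q => ball (hfst p) e (hfst q)) by [].
  move: Fp; apply: filterS => q; rewrite -!ball_normE.
  exact: le_lt_trans (norm_fst_le (p - q)).
have c2 : cvg ((fun p : hsum H G => hsnd p) @ F).
  apply/cauchy_cvgP/cauchyP => e e0; have [p Fp] := Fc e e0; exists (hsnd p).
  suff : F (fun q => ball (hsnd p) e (hsnd q)) by [].
  move: Fp; apply: filterS => q; rewrite -!ball_normE.
  exact: le_lt_trans (norm_snd_le (p - q)).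
move: c1 c2 => /cvg_ex[l1 c1] /cvg_ex[l2 c2].
by apply/cvg_ex; exists (hpair l1 l2); apply: (@cvg_hsum _ F FF id).
Qed.

HB.instance Definition _ := Uniform_isComplete.Build (hsum H G) sum_complete.

Let sum_inner_norm p : hsum_inner p p = `|p| ^+ 2.
Proof. by rewrite hsum_normE -!inner_norm. Qed.

HB.instance Definition _ :=
  @NormedModule_isHilbert.Build R (hsum H G) hsum_inner sum_inner_norm.

Lemma hsum_innerE p q : '[p, q] = '[hfst p, hfst q] + '[hsnd p, hsnd q].
Proof. by []. Qed.

End hsum.

(** * Minimization of a quadratically regularized epigraph *)

Section epigraph.
Context (R : realType) (H : hilbertType R).

(** Divide by [a] and let [a] tend to [0]. *)
Lemma ge0_of_quadratic_ge0 (c d : R) :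
  (forall a, 0 < a <= 1 -> 0 <= a * c + a ^+ 2 * d) -> 0 <= c.
Proof.
move=> h; rewrite leNgt; apply/negP => c0.
have d0 : 0 < d by have := h 1; rewrite ltr01 lexx; lra.
have s0 : 0 < d - c by lra.
(* If [c < 0], this [a] makes [c + a * d] at most [c / 2]. *)
set a := - c / (2 * (d - c)).
have a_gt0 : 0 < a by apply: divr_gt0; lra.
have a_le1 : a <= 1 by rewrite ler_pdivrMr; lra.
have := h a; rewrite a_gt0 a_le1 => /(_ isT).
rewrite expr2 -mulrA -mulrDr pmulr_rge0// leNgt => /negP; apply.
suff : a * d <= - c / 2 by lra.
rewrite /a mulrAC ler_pdivrMr; last lra.
nra.
Qed.

(** When [E] is the epigraph of [f], or just its graph if [f] is affine, [x0] is
    the minimizer of [f + |.|^2 / 2].  It exists because minimizing sequences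
    are Cauchy by the parallelogram identity; the conclusion is its first-order
    optimality condition: [- x0] is a subgradient of [f] at [x0]. *)
Lemma epigraph_prox (E : H -> R -> Prop) (m : R) :
  (exists x t, E x t) ->
  (forall (a : R) x s y t, 0 <= a <= 1 -> E x s -> E y t ->
    E (y + a *: (x - y)) (t + a * (s - t))) ->
  (forall (x : nat -> H) (t : nat -> R) l s, (forall n, E (x n) (t n)) ->
    x @ \oo --> l -> t @ \oo --> s -> E l s) ->
  (forall x t, E x t -> m <= t + '[x, x] / 2) ->
  exists x0 t0, E x0 t0 /\ forall x t, E x t -> t0 - '[x0, x - x0] <= t.
Proof.
move=> [xe [te Ee]] Econv Eclosed Elow.
pose J (x : H) (t : R) : R := t + '[x, x] / 2.
pose S := [set j : R | exists x t, E x t /\ j = J x t].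
have infS : has_inf S.
  split; first by exists (J xe te), xe, te.
  by exists m => _ [x [t [Ext ->]]]; exact: Elow.
have Jinf x t : E x t -> inf S <= J x t.
  by move=> Ext; apply: (ge_inf infS.2); exists x, t.
have approx (n : nat) : exists xt : H * R,
    E xt.1 xt.2 /\ J xt.1 xt.2 < inf S + n.+1%:R^-1.
  have n0 : 0 < n.+1%:R^-1 :> R by rewrite invr_gt0.
  have [_ [x [t [Ext ->]]] lt_J] := inf_adherent n0 infS.
  by exists (x, t).
have [xt xtP] := choice approx.
pose x n := (xt n).1; pose t n := (xt n).2.
have Ex n : E (x n) (t n) by case: (xtP n).
have Jx n : J (x n) (t n) < inf S + n.+1%:R^-1 by case: (xtP n).
have gap n k : `|x n - x k| ^+ 2 <= 4 * (n.+1%:R^-1 + k.+1%:R^-1).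
  have half01 : 0 <= (2^-1 : R) <= 1 by lra.
  have := Jinf _ _ (Econv _ _ _ _ _ half01 (Ex n) (Ex k)).
  rewrite -inner_norm; have := Jx n; have := Jx k.
  rewrite /J !innerE (innerC (x k) (x n)).
  move: (inf S) (t k) (t n) '[x k, x k] '[x n, x n] '[x n, x k].
  by move: n.+1%:R^-1 k.+1%:R^-1 => *; lra.
have xc : cvg (x @ \oo).
  apply/cauchy_cvgP/cauchyP => e e0.
  have [N _ NP] : \forall n \near \oo, n.+1%:R^-1 < e ^+ 2 / 8.
    have /cvgrPdist_lt /(_ (e ^+ 2 / 8)) := @cvg_harmonic R.
    rewrite divr_gt0 ?exprn_gt0// => /(_ isT); apply: filterS => n /=.
    by rewrite sub0r normrN ger0_norm ?invr_ge0.
  exists (x N).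
  suff : \forall n \near \oo, ball (x N) e (x n) by [].
  exists N => // n /= /NP nN; rewrite -ball_normE /ball_ /=.
  rewrite -ltr_sqr ?nnegrE ?(ltW e0)//; apply: le_lt_trans (gap _ _) _.
  have := NP N (leqnn N); move: nN => /=.
  by move: n.+1%:R^-1 N.+1%:R^-1 => *; lra.
move: xc => /cvg_ex[x0 xx0].
have Jcvg : (fun n => J (x n) (t n)) @ \oo --> inf S.
  apply: (@squeeze_cvgr _ _ _ _ (fun=> inf S) (fun n => inf S + n.+1%:R^-1)).
  - by near=> n; rewrite Jinf// ltW.
  - exact: cvg_cst.
  - rewrite -[X in _ --> X]addr0; apply: cvgD; first exact: cvg_cst.
    exact: cvg_harmonic.
have tcvg : t @ \oo --> inf S - '[x0, x0] / 2.
  rewrite (_ : t = fun n => J (x n) (t n) - '[x n, x n] / 2); last first.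
    by apply/funext => n; rewrite /J addrK.
  by apply: cvgB => //; apply: cvgMl; exact: cvg_inner.
have E0 := Eclosed _ _ _ _ Ex xx0 tcvg.
exists x0, (inf S - '[x0, x0] / 2); split=> // y s Eys.
set t0 := _ - _ / 2 in tcvg E0 *.
rewrite -subr_ge0; apply: (@ge0_of_quadratic_ge0 _ ('[y - x0, y - x0] / 2)).
move=> a /andP[a0 a1].
have a01 : 0 <= a <= 1 by rewrite (ltW a0).
have := Jinf _ _ (Econv _ _ _ _ _ a01 Eys E0).
rewrite /J /t0 -subr_ge0 => h; apply: le_trans h _.
rewrite le_eqVlt; apply/orP; left; apply/eqP.
by rewrite !innerE (innerC y x0); field.
Unshelve. all: by end_near. Qed.

(** [epigraph_prox] for the graph of [- f]: the optimality condition of [w],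
    tested at [w + x] and at [w - x], gives the two inequalities between [f x]
    and ['[x, w]]. *)
Lemma Riesz_representation (f : H -> R) (C : R) :
  (forall a x y, f (a *: x + y) = a * f x + f y) ->
  (forall x, `|f x| <= C * `|x|) ->
  exists w, forall x, f x = '[x, w].
Proof.
move=> flin fC.
have f0 : f 0 = 0 by have := flin 1 0 0; rewrite scaler0 addr0; lra.
have fZ a x : f (a *: x) = a * f x by rewrite -[a *: x]addr0 flin f0 addr0.
have fD x y : f (x + y) = f x + f y by rewrite -[x]scale1r flin mul1r scale1r.
have fN x : f (- x) = - f x by rewrite -scaleN1r fZ mulN1r.
have [|||x t Ext|w [t [-> wP]]] :=
  @epigraph_prox (fun x t => t = - f x) (- (C ^+ 2 / 2)).
- by exists 0, (- f 0).
- by move=> a x s y t _ -> ->; rewrite fD fZ fD fN; lra.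
- move=> x t l s xt xl ts.
  have tE : t = fun n => - f (x n) by apply/funext.
  apply: (@cvg_unique _ (@norm_hausdorff _ R^o) (t @ \oo)) => //.
  rewrite tE; apply: cvgN; apply/cvgrPdist_lt => e e0.
  have C0 : 0 < `|C| + 1 by rewrite ltr_wpDl.
  move: xl => /cvgrPdist_lt /(_ (e / (`|C| + 1))).
  rewrite divr_gt0// => /(_ isT).
  apply: filterS => n; rewrite -fN -fD ltr_pdivlMr// => h.
  apply: le_lt_trans (fC _) _; apply: le_lt_trans h; rewrite mulrC ler_wpM2l//.
  by have := ler_norm C; lra.
- rewrite Ext inner_norm.
  have := fC x; have := ler_norm (f x); have := sqr_ge0 (`|x| - C).
  rewrite expr2 mulrBl !mulrBr; rewrite !expr2; nra.
- exists w => x.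
  have := wP (w + x) _ erefl; have := wP (w - x) _ erefl.
  rewrite !fD fN addrAC subrr add0r (addrC w) addrK innerNr (innerC x); lra.
Qed.

End epigraph.

(** * Maximally monotone operators *)

Section maximal.
Context (R : realType) (H : hilbertType R).
Implicit Types (M : H -> set H).

(** Adding a point to the graph keeps the operator monotone exactly when the
    point is monotonically related to the graph. *)
Lemma maximally_monotoneP M : maximally_monotone M <->
  (forall x u y v, M x u -> M y v -> 0 <= '[x - y, u - v]) /\
  forall x u, (forall y v, M y v -> 0 <= '[x - y, u - v]) -> M x u.
Proof.
split=> [[Mmono Mmax]|[Mmono Mmax]]; split=> //.
- move=> x u xu; apply: contrapT => nMxu; apply: Mmax.
  exists (fun y v => M y v \/ y = x /\ v = u); split.
    move=> y v y' v'; rewrite /op_gra /=; move=> [Myv|[-> ->]] [My'v'|[-> ->]].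
    + exact: Mmono.
    + have := xu _ _ Myv; rewrite -(opprB x y) -(opprB u v) innerNl innerNr.
      by rewrite opprK.
    + exact: xu.
    + by rewrite !subrr inner0l.
  split; first by move=> [y v] /=; left.
  by move=> /(_ (x, u)) /= => h; apply: nMxu; apply: h; right.
- move=> [N [Nmono [MN NM]]]; apply: NM => -[x u] /= Nxu.
  by apply: Mmax => y v Myv; apply: Nmono => //; exact: (MN (y, v)).
Qed.

Lemma maximally_monotone_scale c M : 0 < c -> maximally_monotone M ->
  maximally_monotone (op_scale c M).
Proof.
move=> c0 /maximally_monotoneP[Mmono Mmax]; apply/maximally_monotoneP; split.
  move=> x _ y _ [u Mxu <-] [v Myv <-].
  by rewrite -scalerBr innerZr mulr_ge0 ?(ltW c0)//; exact: Mmono.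
move=> x u xu; exists (c^-1 *: u); last first.
  by rewrite scalerA divff ?gt_eqF ?scale1r.
apply: Mmax => y v Myv.
have := xu y (c *: v) (ex_intro2 _ _ v Myv erefl).
rewrite -[u in '[_, u - _]](@scalerKV _ _ c) ?gt_eqF// -scalerBr innerZr.
by rewrite pmulr_rge0.
Qed.

Lemma maximally_monotone_inv M : maximally_monotone M ->
  maximally_monotone (op_inv M).
Proof.
move=> /maximally_monotoneP[Mmono Mmax]; apply/maximally_monotoneP; split.
  by move=> x u y v Mux Mvy; rewrite innerC; exact: Mmono.
by move=> x u xu; apply: Mmax => y v Myv; rewrite innerC; exact: xu.
Qed.

Definition op_shift M (w : H) : H -> set H := fun x => [set u | M x (u + w)].

Lemma maximally_monotone_shift M w : maximally_monotone M ->
  maximally_monotone (op_shift M w).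
Proof.
move=> /maximally_monotoneP[Mmono Mmax]; apply/maximally_monotoneP; split.
  move=> x u y v Mxu Myv.
  by have := Mmono _ _ _ _ Mxu Myv; rewrite opprD addrACA subrr addr0.
move=> x u xu; apply: Mmax => y v Myv.
have := xu y (v - w); rewrite /op_shift /= subrK opprB addrA => /(_ Myv).
by rewrite (addrAC u).
Qed.

(** The regularized Fitzpatrick function
    [F (x, u) + |(x, u)|^2 / 2], with
    [F (x, u) = sup_((y, v) in gra M) ('[x, v] + '[y, u] - '[y, v])],
    has a minimizer [(a, b)].  As [F >= '[., .]] everywhere with equality on the
    graph, optimality against the points of the graph says that
    [(- b, - a)] is monotonically related to the graph, hence lies in it;
    optimality against that point then forces [b = - a]. *)
Lemma Minty M : maximally_monotone M -> exists x, M x (- x).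
Proof.
move=> /maximally_monotoneP[Mmono Mmax].
pose E (p : hsum H H) (t : R) := forall y v, M y v ->
  '[hfst p, v] + '[y, hsnd p] - '[y, v] <= t.
have Fitzpatrick p t : E p t -> '[hfst p, hsnd p] <= t.
  move=> Ept; rewrite leNgt; apply/negP => lt_t.
  have Mp : M (hfst p) (hsnd p).
    apply: Mmax => y v Myv; have := Ept _ _ Myv.
    by rewrite !innerE; lra.
  by have := Ept _ _ Mp; lra.
have E_graph y v : M y v -> E (hpair y v) '[y, v].
  move=> Myv y' v' My'v'; have := Mmono _ _ _ _ Myv My'v'.
  by rewrite /hfst /hsnd /= !innerE; lra.
have [y0 [v0 M0]] : exists y v, M y v.
  apply: contrapT => Mempty; case: (Mempty); exists 0, 0.
  apply: Mmax => y v Myv.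
  by exfalso; apply: Mempty; exists y, v.
have [||||p [t [Ept pP]]] := @epigraph_prox R (hsum H H) E 0.
- by exists (hpair y0 v0), '[y0, v0]; exact: E_graph.
- move=> a x s y t /andP[a0 a1] Exs Eyt y' v' Myv.
  have convex (ex ey : R) : ex <= s -> ey <= t ->
    ey + a * (ex - ey) <= t + a * (s - t) by nra.
  apply: le_trans (convex _ _ (Exs _ _ Myv) (Eyt _ _ Myv)).
  by rewrite !hsumE !innerE le_eqVlt; apply/orP; left; apply/eqP; ring.
- move=> x t l s Ext xl ts y v Myv.
  apply: (@ler_cvg_to _ _ _ _ (fun n => '[hfst (x n), v] + '[y, hsnd (x n)] -
    '[y, v]) t _ _ _ ts); last by apply: nearW => n; exact: Ext.
  apply: cvgB; last exact: cvg_cst.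
  apply: cvgD; apply: cvg_inner; try exact: cvg_cst.
    exact: cvg_hfst.
  exact: cvg_hsnd.
- move=> p t /Fitzpatrick pt; rewrite hsum_innerE.
  have := inner_ge0 (hfst p + hsnd p); rewrite !innerE (innerC (hsnd p)); lra.
set a := hfst p in Ept pP *; set b := hsnd p in Ept pP *.
have opt y v : M y v ->
    t + '[a, a] + '[b, b] <= '[y, v] + '[a, y] + '[b, v].
  move=> /E_graph /pP; rewrite hsum_innerE -/a -/b.
  by rewrite !hsumE -/a -/b !innerE; lra.
have abt := Fitzpatrick _ _ Ept; rewrite -/a -/b in abt.
have Mba : M (- b) (- a).
  apply: Mmax => y v /opt; have := inner_ge0 (a + b).
  by rewrite !innerE (innerC b a) (innerC y a); lra.
have ab0 : a + b = 0.
  apply: inner_eq0; apply: le_anti; rewrite inner_ge0 andbT.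
  have := opt _ _ Mba; rewrite !innerE (innerC b a); lra.
exists (- b); rewrite opprK -[b in X in M _ X](addKr a) ab0 addr0.
exact: Mba.
Qed.

(** This is where the resolvent is shown to be defined at [w]: the zero of
    [Id + N] given by [Minty] for the operator [N : x |-> c M (x + w)] is
    [p - w], where [p] is the value of the resolvent. *)
Lemma resolventP M c w : 0 < c -> maximally_monotone M ->
  M (resolvent (op_scale c M) w) (c^-1 *: (w - resolvent (op_scale c M) w)).
Proof.
move=> c0 Mmax.
(* Shifting the values of the inverse translates the argument. *)
have [x [u Mxu cux]] := Minty (maximally_monotone_inv
  (maximally_monotone_shift w
    (maximally_monotone_inv (maximally_monotone_scale c0 Mmax)))).
have : op_inv (op_id_add (op_scale c M)) w (resolvent (op_scale c M) w).
  apply: (@xgetI _ _ _ (x + w)); exists (- x); last first.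
    by rewrite addrAC subrr add0r.
  by exists u.
case=> _ [v Mv <-] /= {2}<-; rewrite addrAC subrr add0r scalerA.
by rewrite mulVf ?gt_eqF// scale1r.
Qed.

Lemma resolvent_inequality M c w w' p p' : 0 < c -> maximally_monotone M ->
  M p (c^-1 *: (w - p)) -> M p' (c^-1 *: (w' - p')) -> `|p - p'| <= `|w - w'|.
Proof.
move=> c0 /maximally_monotoneP[Mmono _] Mp Mp'.
have := Mmono _ _ _ _ Mp Mp'.
rewrite -scalerBr innerZr pmulr_rge0 ?invr_gt0//.
have -> : w - p - (w' - p') = (w - w') - (p - p').
  by rewrite !opprB [p' - w']addrC addrACA [- p + p']addrC.
set d := p - p'; set e := w - w' => h.
have [d0|d0] := eqVneq `|d| 0; first by rewrite d0.
rewrite -(@ler_pM2l _ `|d|); last by rewrite lt_def d0 normr_ge0.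
apply: le_trans (inner_le d e); rewrite -expr2 -inner_norm.
by move: h; rewrite innerDr innerNr subr_ge0.
Qed.

Lemma resolvent_nonexpansive M c w w' : 0 < c -> maximally_monotone M ->
  `|resolvent (op_scale c M) w - resolvent (op_scale c M) w'| <= `|w - w'|.
Proof.
by move=> c0 Mmax; apply: (resolvent_inequality c0 Mmax); exact: resolventP.
Qed.

Lemma resolvent_unique M c w p : 0 < c -> maximally_monotone M ->
  M p (c^-1 *: (w - p)) -> resolvent (op_scale c M) w = p.
Proof.
move=> c0 Mmax Mp; apply/subr0_eq/eqP.
rewrite -normr_le0 -(normr0 H) -(subrr w).
exact: (resolvent_inequality c0 Mmax) (resolventP w c0 Mmax) Mp.
Qed.

End maximal.

(** * Weak limits *)

Section weak.
Context (R : realType) (H : hilbertType R).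

Lemma cvg_ultra_bounded (f : nat -> R) (C : R) (U : set_system nat) :
  UltraFilter U -> (forall n, `|f n| <= C) -> cvg (f @ U).
Proof.
move=> UU fC.
have [|l [_ lU]] := @segment_compact R (- C) C (f @ U) _.
  by apply: nearW => n /=; rewrite in_itv /= -ler_norml.
apply/cvg_ex; exists l => A Al.
have [//|UnA] := in_ultra_setVsetC (f @^-1` A) UU.
by have [r [/= nAr Ar]] := lU (~` A) A UnA Al.
Qed.

(** The functional that maps [u] to the limit of ['[x n, u]] is linear and
    bounded. *)
Lemma weak_cvg_ultra (x : nat -> H) (C : R) (U : set_system nat) :
  UltraFilter U -> (forall n, `|x n| <= C) ->
  exists l : H, forall u, (fun n => '[x n, u]) @ U --> '[l, u].
Proof.
move=> UU xC.
have bound (u : H) n : `|'[x n, u]| <= C * `|u|.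
  by apply: le_trans (abs_inner_le _ _) _; rewrite ler_wpM2r.
have xcvg (u : H) : (fun n => '[x n, u]) @ U --> lim ((fun n => '[x n, u]) @ U).
  exact: (cvg_ultra_bounded UU (bound u)).
have [||l lP] := @Riesz_representation R H
  (fun u => lim ((fun n => '[x n, u]) @ U)) C.
- move=> a u v; apply: (@cvg_lim R^o) => //.
  under eq_fun do rewrite innerDr innerZr.
  by apply: cvgD => //; apply: cvgMr; exact: xcvg.
- move=> u.
  apply: (@ler_cvg_to _ U _ _ (fun n => `|'[x n, u]|) (fun=> C * `|u|)).
  + by apply: cvg_norm; exact: xcvg.
  + exact: cvg_cst.
  + by apply: nearW => n; exact: bound.
- by exists l => u; rewrite innerC -lP.
Qed.

(** Opial's lemma: if the distances to two weak cluster points [l] and [l']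
    converge, then so does ['[x n, l - l']], whose limits along two
    ultrafilters are ['[l, l - l']] and ['[l', l - l']]; hence [l = l']. *)
Lemma Opial (x : nat -> H) (C : R) (Z : set H) :
  (forall n, `|x n| <= C) ->
  (forall z, Z z -> cvg ((fun n => `|x n - z|) @ \oo)) ->
  (forall (U : set_system nat) l, UltraFilter U -> \oo `<=` U ->
    (forall u, (fun n => '[x n, u]) @ U --> '[l, u]) -> Z l) ->
  exists2 l, Z l & weak_cvg x l.
Proof.
move=> xC xZ clusterZ.
have [U [UU ooU]] := @ultraFilterLemma nat \oo _.
have [l xl] := weak_cvg_ultra UU xC.
have Zl := clusterZ _ _ UU ooU xl.
exists l => // u; apply/cvgrPdist_lt => e e0.
apply: contrapT => nfar.
pose far := [set n | ~ `|'[l, u] - '[x n, u]| < e].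
have far_proper : ProperFilter (within far \oo).
  apply: Build_ProperFilter => //.
  move=> h; apply: nfar; apply: (@filterS _ \oo _ _ _ _ h) => n.
  exact: contrapT.
have [U' [UU' farU']] := @ultraFilterLemma nat (within far \oo) _.
have U'far : U' far by apply: farU'; exact: withinT.
have ooU' : \oo `<=` U' by move=> A ooA; apply: farU'; exact: cvg_within ooA.
have [l' xl'] := weak_cvg_ultra UU' xC.
have Zl' := clusterZ _ _ UU' ooU' xl'.
have sqr_cvg z : Z z -> cvg ((fun n => `|x n - z| ^+ 2) @ \oo).
  by move=> /xZ xz; under eq_fun do rewrite expr2; exact: is_cvgM.
have ll' : l' = l.
  pose d n := `|x n - l'| ^+ 2 - `|x n - l| ^+ 2.
  have dE n : '[x n, l - l'] = 2^-1 * (d n - `|l'| ^+ 2 + `|l| ^+ 2).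
    by rewrite /d !sqr_normB innerDr innerNr; field.
  have : cvg ((fun n => '[x n, l - l']) @ \oo).
    under eq_fun do rewrite dE.
    apply: is_cvgMr; apply: is_cvgD; last exact: is_cvg_cst.
    apply: is_cvgB; last exact: is_cvg_cst.
    by apply: is_cvgB; exact: sqr_cvg.
  move=> /cvg_ex[s xs].
  have sl : '[l, l - l'] = s.
    apply: (@cvg_unique _ (@norm_hausdorff _ R^o) _ _ _ _ (xl (l - l'))).
    by move=> A /xs; exact: ooU.
  have sl' : '[l', l - l'] = s.
    apply: (@cvg_unique _ (@norm_hausdorff _ R^o) _ _ _ _ (xl' (l - l'))).
    by move=> A /xs; exact: ooU'.
  apply/esym/subr0_eq/inner_eq0; rewrite [LHS]innerDl innerNl sl sl' subrr.
  by [].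
have U'near : U' [set n | `|'[l, u] - '[x n, u]| < e].
  by have := xl' u; rewrite ll' => /cvgrPdist_lt /(_ e e0).
have [n [/= + ?]] := @filter_ex _ _ _ _ (filterI U'far U'near).
exact.
Qed.

Lemma weak_cvg_bounded_dist (x y : nat -> H) l :
  weak_cvg x l -> (fun n => x n - y n) @ \oo --> (0 : H) -> weak_cvg y l.
Proof.
move=> xl xy u.
rewrite (_ : (fun n => _) = fun n => '[x n, u] - '[x n - y n, u]); last first.
  by apply/funext => n; rewrite innerDl innerNl opprB addrCA subrr addr0.
rewrite -[X in _ --> X]subr0 -(inner0l u); apply: cvgB; first exact: xl.
by apply: cvg_inner => //; exact: cvg_cst.
Qed.

End weak.

Section weak_hsum.
Context (R : realType) (H G : hilbertType R).

Lemma weak_cvg_hfst (f : nat -> hsum H G) l :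
  weak_cvg f l -> weak_cvg (fun n => hfst (f n)) (hfst l).
Proof.
move=> fl u; have := fl (hpair u 0); rewrite hsum_innerE !hsumE inner0r addr0.
by under eq_fun do rewrite hsum_innerE !hsumE inner0r addr0.
Qed.

Lemma weak_cvg_hsnd (f : nat -> hsum H G) l :
  weak_cvg f l -> weak_cvg (fun n => hsnd (f n)) (hsnd l).
Proof.
move=> fl u; have := fl (hpair 0 u); rewrite hsum_innerE !hsumE inner0r add0r.
by under eq_fun do rewrite hsum_innerE !hsumE inner0r add0r.
Qed.

End weak_hsum.

(** * Tseng's splitting with errors *)

Section sequences.
Context (R : realType).
Implicit Types (a e : nat -> R).

Lemma abs_summable_cvg (V : normedModType R) (u : nat -> V) :
  abs_summable u -> cvg (series (fun n => `|u n|) @ \oo).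
Proof.
move=> us; set l := (\sum_(0 <= n <oo) `|u n|%:E)%E in us.
have l0 : (0 <= l)%E by apply: nneseries_ge0 => n _ _; rewrite lee_fin.
have lfin : l \is a fin_num by rewrite ge0_fin_numE.
apply: nondecreasing_is_cvgn; first exact: nondecreasing_series.
exists (fine l) => _ [n _ <-]; rewrite -lee_fin fineK// /series /= -sumEFin.
by apply: nneseries_lim_ge => k _; rewrite lee_fin.
Qed.

Lemma cvg_norm_le (V : normedModType R) (u : nat -> V) :
  cvg (u @ \oo) -> exists C, forall n, `|u n| <= C.
Proof.
move=> /cvg_seq_bounded[B [_ BP]]; exists (B + 1) => n.
by apply: BP => //; rewrite ltrDl.
Qed.

Lemma cvg_series_le a e : (forall n, 0 <= a n <= e n) ->
  cvg (series e @ \oo) -> cvg (series a @ \oo).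
Proof.
move=> ae; apply: series_le_cvg => n; have /andP[a0 le_ae] := ae n => //.
exact: le_trans le_ae.
Qed.

(** [a n - series e n] is nonincreasing and bounded below. *)
Lemma quasi_Fejer_cvg a e : (forall n, 0 <= a n) -> (forall n, 0 <= e n) ->
  (forall n, a n.+1 <= a n + e n) -> cvg (series e @ \oo) -> cvg (a @ \oo).
Proof.
move=> a0 e0 ae ecvg.
have [C eC] : exists C, forall n, series e n <= C.
  exists (lim (series e @ \oo)) => n.
  by apply: nondecreasing_cvgn_le => //; exact: nondecreasing_series.
rewrite (_ : a = fun n => (a n - series e n) + series e n); last first.
  by apply/funext => n; rewrite subrK.
apply: is_cvgD => //; apply: nonincreasing_is_cvgn.
  apply/nonincreasing_seqP => n.
  by have := ae n; rewrite seriesSr /=; lra.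
by exists (- C) => _ [n _ <-]; have := a0 n; have := eC n; lra.
Qed.

End sequences.

Section Tseng.
Context (R : realType) (V : hilbertType R).
Variables (M : V -> set V) (S : V -> V) (beta eps : R) (gamma : nat -> R).
Hypothesis M_max : maximally_monotone M.
Hypothesis S_linear : linear S.
Hypothesis S_skew : forall p, '[S p, p] = 0.
Hypothesis beta_gt0 : 0 < beta.
Hypothesis S_bounded : forall p, `|S p| <= beta * `|p|.
Hypothesis eps_gt0 : 0 < eps.
Hypothesis gamma_bounds : forall n, eps <= gamma n <= (1 - eps) / beta.

Let SB p q : S (p - q) = S p - S q.
Proof. by rewrite addrC -scaleN1r S_linear scaleN1r addrC. Qed.

Let SD p q : S (p + q) = S p + S q.
Proof. by rewrite -[p]scale1r S_linear !scale1r. Qed.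

Lemma skewC p q : '[S p, q] = - '[p, S q].
Proof.
have := S_skew (p + q); rewrite SD !innerE !S_skew (innerC p); lra.
Qed.

Let M_mono : forall x u y v, M x u -> M y v -> 0 <= '[x - y, u - v].
Proof. by have [] := (maximally_monotoneP M).1 M_max. Qed.

Let gamma_gt0 n : 0 < gamma n.
Proof. by have /andP[+ _] := gamma_bounds n; exact: lt_le_trans. Qed.

Let gamma_beta n : gamma n * beta <= 1 - eps.
Proof. by have /andP[_ +] := gamma_bounds n; rewrite ler_pdivlMr. Qed.

(** One exact step from [x]: a forward step with [S], a backward step to [p],
    and a forward correction.  The skewness of [S] turns the monotonicity of [M]
    between [p] and the zero [z] into
    ['[p - z, x - p] >= g * '[p - z, S (x - p)]]. *)
Lemma descent (g : R) x p z : 0 < g ->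
  M p (g^-1 *: (x - p) - S x) -> M z (- S z) ->
  `|p + g *: (S x - S p) - z| ^+ 2 <=
  `|x - z| ^+ 2 - (1 - (g * beta) ^+ 2) * `|x - p| ^+ 2.
Proof.
move=> g0 Mp Mz.
set d := x - p; set h := p - z.
have Sd : '[S d, S d] <= beta ^+ 2 * '[d, d].
  by rewrite !inner_norm -exprMn ler_sqr ?nnegrE ?mulr_ge0// ltW.
have hd : h + d = x - z by rewrite addrC addrA subrK.
have mono : g * '[h, S d] <= '[h, d].
  have := M_mono Mp Mz; rewrite -/d -/h opprK -addrA addrC.
  have -> : - S x + S z = - (S h + S d).
    by rewrite -SD hd SB opprB addrC.
  rewrite innerDr innerZr innerNr innerDr (innerC h (S h)) S_skew add0r.
  by rewrite -(ler_pM2l g0) mulr0 mulrDr mulrN mulrA divff ?gt_eqF// mul1r; lra.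
have -> : p + g *: (S x - S p) - z = h + g *: S d by rewrite -SB addrAC.
rewrite -hd; clear hd Mp; clearbody d h.
rewrite -!inner_norm !innerE (innerC d h) (innerC (S d) h).
have : g ^+ 2 * '[S d, S d] <= g ^+ 2 * (beta ^+ 2 * '[d, d]).
  by rewrite ler_pM2l ?exprn_gt0.
by rewrite !expr2; nra.
Qed.

Section iteration.
Variables (a b c x y p q : nat -> V).
Hypothesis a_sum : cvg (series (fun n => `|a n|) @ \oo).
Hypothesis b_sum : cvg (series (fun n => `|b n|) @ \oo).
Hypothesis c_sum : cvg (series (fun n => `|c n|) @ \oo).
Hypothesis yE : forall n, y n = x n - gamma n *: (S (x n) + a n).
Hypothesis pE : forall n, p n = resolvent (op_scale (gamma n) M) (y n) + b n.
Hypothesis qE : forall n, q n = p n - gamma n *: (S (p n) + c n).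
Hypothesis xE : forall n, x n.+1 = x n - y n + q n.

(** The backward point and the end point of the step that starts from [x n]
    and makes no error. *)
Let pt n := resolvent (op_scale (gamma n) M) (x n - gamma n *: S (x n)).
Let xt n := pt n + gamma n *: (S (x n) - S (pt n)).

(** The residual of [pt n]: an element of [(M + S) (pt n)]. *)
Let w n := (gamma n)^-1 *: (x n - pt n) - S (x n - pt n).

(** As [gamma n <= beta^-1] and [gamma n * beta <= 1], the error [a n] reaches
    [x n.+1] through [y n] and, at most doubled, through [p n], which gives
    [3 / beta]; likewise [b n] is at most doubled, and [c n] is scaled by at
    most [beta^-1]. *)
Let K := 3 / beta + 2.
Let e n := K * (`|a n| + `|b n| + `|c n|).

Let e_ge0 n : 0 <= e n.
Proof. by rewrite mulr_ge0 ?addr_ge0 ?divr_ge0 ?(ltW beta_gt0). Qed.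

Let e_sum : cvg (series e @ \oo).
Proof.
rewrite /e; apply: (is_cvg_seriesZ (k := K)).
by rewrite seriesD; apply: is_cvgD => //; rewrite seriesD; exact: is_cvgD.
Qed.

Let e_cvg0 : e @ \oo --> (0 : R).
Proof. exact: cvg_series_cvg_0. Qed.

Let gamma_le n : gamma n <= beta^-1.
Proof.
rewrite -[beta^-1]mul1r ler_pdivlMr//; apply: le_trans (gamma_beta n) _.
by rewrite gerBl ltW.
Qed.

Let p_pt n : `|p n - pt n| <= gamma n * `|a n| + `|b n|.
Proof.
rewrite pE addrAC; apply: le_trans (ler_normD _ _) _; rewrite lerD2r.
apply: le_trans (resolvent_nonexpansive _ _ (gamma_gt0 n) M_max) _.
have -> : y n - (x n - gamma n *: S (x n)) = - (gamma n *: a n).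
  by rewrite yE; apply: inner_inj => u; rewrite !innerE; ring.
by rewrite normrN normrZ gtr0_norm.
Qed.

Let x_xt n : `|x n.+1 - xt n| <= e n.
Proof.
have -> : x n.+1 - xt n = gamma n *: a n
    + ((p n - pt n) - gamma n *: S (p n - pt n)) - gamma n *: c n.
  by rewrite xE qE /xt yE SB; apply: inner_inj => u; rewrite !innerE; ring.
have g_ge0 : 0 <= gamma n by exact: ltW.
have gbeta : gamma n * beta <= 1.
  by apply: le_trans (gamma_beta n) _; rewrite gerBl ltW.
have gle := gamma_le n.
have Sp : `|gamma n *: S (p n - pt n)| <= `|p n - pt n|.
  rewrite normrZ ger0_norm//; apply: le_trans (ler_wpM2l g_ge0 (S_bounded _)) _.
  by rewrite mulrA ler_piMl.
apply: le_trans (ler_normB _ _) _.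
apply: le_trans (lerD (ler_normD _ _) (lexx _)) _.
apply: le_trans (lerD (lerD (lexx _) (ler_normB _ _)) (lexx _)) _.
rewrite [`|gamma n *: a n|]normrZ [`|gamma n *: c n|]normrZ ger0_norm//.
have le_a : gamma n * `|a n| <= beta^-1 * `|a n| by rewrite ler_wpM2r.
have le_c : gamma n * `|c n| <= beta^-1 * `|c n| by rewrite ler_wpM2r.
have := p_pt n; move: Sp le_a le_c; rewrite /e /K.
have binv0 : 0 <= beta^-1 by rewrite invr_ge0 ltW.
have := mulr_ge0 binv0 (normr_ge0 (a n)).
have := mulr_ge0 binv0 (normr_ge0 (b n)).
have := mulr_ge0 binv0 (normr_ge0 (c n)).
have := normr_ge0 (a n); have := normr_ge0 (b n); have := normr_ge0 (c n).
move: beta^-1 (gamma n * `|a n|) (gamma n * `|c n|) `|a n| `|b n| `|c n|.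
move: `|gamma n *: S (p n - pt n)| `|p n - pt n| => *.
lra.
Qed.

Let pt_resolvent n : M (pt n) ((gamma n)^-1 *: (x n - pt n) - S (x n)).
Proof.
have := resolventP (x n - gamma n *: S (x n)) (gamma_gt0 n) M_max.
by rewrite -/(pt n) addrAC scalerBr scalerA mulVf ?gt_eqF// scale1r.
Qed.

Let pt_graph n : M (pt n) (w n - S (pt n)).
Proof. by rewrite /w SB opprB addrA addrAC addrK; exact: pt_resolvent. Qed.

Section zero.
Variables (z : V) (Mz : M z (- S z)).

Let step n : `|xt n - z| ^+ 2 <= `|x n - z| ^+ 2 - eps * `|x n - pt n| ^+ 2.
Proof.
apply: le_trans (descent (gamma_gt0 n) _ Mz) _.
  exact: pt_resolvent.
rewrite lerD2l lerN2 ler_wpM2r ?sqr_ge0//.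
have := gamma_beta n.
have : 0 <= gamma n * beta by rewrite mulr_ge0 ?ltW.
(* [1 - t ^+ 2 >= 1 - t >= eps] *)
move: eps_gt0 (gamma n * beta) => e0 t t0 t1; rewrite expr2; nra.
Qed.

Let xt_le n : `|xt n - z| <= `|x n - z|.
Proof.
rewrite -ler_sqr ?nnegrE//; apply: le_trans (step n) _.
by rewrite gerBl mulr_ge0 ?sqr_ge0 ?ltW.
Qed.

Let x_le n : `|x n.+1 - z| <= `|xt n - z| + e n.
Proof.
have -> : x n.+1 - z = (xt n - z) + (x n.+1 - xt n).
  by rewrite [RHS]addrC addrA subrK.
by apply: le_trans (ler_normD _ _) _; rewrite lerD2l.
Qed.

Lemma dist_zero_cvg : cvg ((fun n => `|x n - z|) @ \oo).
Proof.
apply: (@quasi_Fejer_cvg _ _ e) => // n.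
by apply: le_trans (x_le n) _; rewrite lerD2r.
Qed.

(** The distances from [x n], [x n.+1] and [xt n] to [z] have the same limit,
    and [step] bounds [x n - pt n] by the difference of the squares of the
    first and the last. *)
Lemma x_pt_cvg0_of_zero : (fun n => x n - pt n) @ \oo --> (0 : V).
Proof.
move: dist_zero_cvg => /cvg_ex[rho xrho].
have xrho' : (fun n => `|x n.+1 - z|) @ \oo --> rho.
  by rewrite (cvg_shiftS (fun n => `|x n - z|)).
have xtrho : (fun n => `|xt n - z|) @ \oo --> rho.
  apply: (@squeeze_cvgr _ _ _ _ (fun n => `|x n.+1 - z| - e n)
    (fun n => `|x n - z|)) => //.
  - by apply: nearW => n; rewrite xt_le andbT lerBlDr.
  - by rewrite -[rho]subr0; exact: cvgB.
have d0 : (fun n => `|x n - pt n| ^+ 2) @ \oo --> (0 : R).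
  apply: (@squeeze_cvgr _ _ _ _ (fun=> 0)
    (fun n => eps^-1 * (`|x n - z| * `|x n - z| - `|xt n - z| * `|xt n - z|))).
  - apply: nearW => n; rewrite sqr_ge0 /= ler_pdivlMl// -!expr2.
    by have := step n; lra.
  - exact: cvg_cst.
  - rewrite -[X in _ --> X](mulr0 eps^-1); apply: cvgMr.
    by rewrite -(subrr (rho * rho)); apply: cvgB; exact: cvgM.
apply/cvgrPdist_lt => r r0.
move: d0 => /cvgrPdist_lt /(_ (r ^+ 2)); rewrite exprn_gt0// => /(_ isT).
apply: filterS => n; rewrite !sub0r !normrN ger0_norm ?sqr_ge0//.
by rewrite ltr_sqr ?nnegrE// ltW.
Qed.

End zero.

(** The point [l] comes from [Opial].  That weak cluster points are zeros holds
    because, for [v] in [M y], the inequality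
    ['[pt n - y, w n - S (pt n) - v] >= 0] contains [S (pt n)] only through
    ['[y, S (pt n)]], as [S] is skew: it is affine in [pt n] up to a null
    sequence, and survives weak limits. *)
Lemma Tseng_splitting : (exists z, M z (- S z)) ->
  exists l, [/\ M l (- S l), weak_cvg x l,
    (fun n => x n - p n) @ \oo --> (0 : V) &
    exists pt w : nat -> V, [/\ forall n, M (pt n) (w n - S (pt n)),
      (fun n => x n - pt n) @ \oo --> (0 : V) &
      (fun n => '[pt n - l, w n]) @ \oo --> (0 : R)]].
Proof.
move=> [z Mz].
have xpt := x_pt_cvg0_of_zero Mz.
have ptp : (fun n => pt n - p n) @ \oo --> (0 : V).
  apply/norm_cvg0P; apply: (@squeeze_cvgr _ _ _ _ (fun=> 0)
    (fun n => beta^-1 * `|a n| + `|b n|)).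
  - apply: nearW => n; rewrite normr_ge0 distrC /=; apply: le_trans (p_pt n) _.
    by rewrite lerD2r ler_wpM2r.
  - exact: cvg_cst.
  - rewrite -[X in _ --> X]addr0 -[X in _ --> X + _](mulr0 beta^-1).
    by apply: cvgD; [apply: cvgMr|]; exact: cvg_series_cvg_0.
have w0 : w @ \oo --> (0 : V).
  apply/norm_cvg0P; apply: (@squeeze_cvgr _ _ _ _ (fun=> 0)
    (fun n => (eps^-1 + beta) * `|x n - pt n|)).
  - apply: nearW => n; rewrite normr_ge0 /= /w.
    apply: le_trans (ler_normB _ _) _; rewrite mulrDl lerD ?S_bounded//.
    rewrite normrZ ler_wpM2r// gtr0_norm ?invr_gt0// lef_pV2 ?posrE//.
    by have /andP[] := gamma_bounds n.
  - exact: cvg_cst.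
  - rewrite -[X in _ --> X](mulr0 (eps^-1 + beta)); apply: cvgMr.
    exact/norm_cvg0P.
have [C xC] : exists C, forall n, `|x n| <= C.
  have [C xzC] := cvg_norm_le (dist_zero_cvg Mz); exists (C + `|z|) => n.
  rewrite -[x n](subrK z); apply: le_trans (ler_normD _ _) _.
  by rewrite lerD2r -[leLHS]normr_id.
have [C' ptC'] : exists C, forall n, `|pt n| <= C.
  have [C' dC'] := cvg_norm_le (cvgP _ xpt); exists (C + C') => n.
  rewrite -[pt n](subKr (x n)); apply: le_trans (ler_normB _ _) _.
  exact: lerD.
have ptC'_shift v n : `|pt n - v| <= C' + `|v|.
  by apply: le_trans (ler_normB _ _) _; rewrite lerD2r.
have [l Ml xl] : exists2 l, M l (- S l) & weak_cvg x l.
  apply: (@Opial _ _ x C [set l | M l (- S l)] xC); first exact: dist_zero_cvg.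
  move=> U l UU ooU xl.
  have ptl u : (fun n => '[pt n, u]) @ U --> '[l, u].
    rewrite (_ : (fun n => _) = fun n => '[x n, u] - '[x n - pt n, u]);
      last first.
      by apply/funext => n; rewrite !innerE; ring.
    rewrite -[X in _ --> X]subr0 -(inner0l u); apply: cvgB; first exact: xl.
    apply: cvg_trans (cvg_inner xpt (cvg_cst u)).
    by move=> A hA; exact: ooU.
  have [_ M_maximal] := (maximally_monotoneP M).1 M_max.
  apply: M_maximal => y' v Myv.
  have -> : '[l - y', - S l - v] = 0 - '[l, v + S y'] + '[y', v].
    by rewrite !innerE (innerC l (S l)) S_skew (innerC l (S y')) skewC; ring.
  apply: (@ler_cvg_to _ U _ _ (fun=> 0) (fun n => '[pt n - y', w n] -
    '[pt n, v + S y'] + '[y', v])).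
  - exact: cvg_cst.
  - apply: cvgD; last exact: cvg_cst.
    apply: cvgB; last exact: ptl.
    have := @cvg_inner0_bounded _ _ _ \oo _ _ w (C' + `|y'|) (ptC'_shift y') w0.
    by move=> h A /h; exact: ooU.
  - apply: nearW => n; have := M_mono (pt_graph n) Myv.
    rewrite !innerE (innerC (pt n) (S (pt n))) S_skew.
    have -> : '[y', S (pt n)] = - '[pt n, S y'] by rewrite -skewC innerC.
    by lra.
exists l; split => //.
  rewrite (_ : (fun n => _) = fun n => (x n - pt n) + (pt n - p n)).
    by rewrite -[X in _ --> X]addr0; exact: cvgD.
  by apply/funext => n; rewrite addrA subrK.
exists pt, w; split => //.
exact: cvg_inner0_bounded (ptC'_shift l) w0.
Qed.

End iteration.
End Tseng.

(** * Adjoints *)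

Section adjoint.
Context (R : realType) (H G : hilbertType R) (L : {linear H -> G}).
Hypothesis L_bounded : bounded_fun_norm L.

Let ball_has_sup : has_sup [set `|L x| | x in [set x : H | `|x| <= 1]].
Proof.
split; first by exists `|L 0|, 0 => //=; rewrite normr0.
by have [C LC] := L_bounded 1; exists C => _ [x x1 <-]; exact: LC.
Qed.

Lemma opnormP x : `|L x| <= opnorm L * `|x|.
Proof.
have [->|x0] := eqVneq x 0; first by rewrite linear0 !normr0 mulr0.
rewrite -ler_pdivrMr ?normr_gt0//.
apply: (sup_upper_bound ball_has_sup); exists (`|x|^-1 *: x) => /=.
  by rewrite normrZ normfV normr_id mulVf ?normr_eq0.
by rewrite linearZ /= normrZ normfV normr_id mulrC.
Qed.

Lemma opnorm_ge0 : 0 <= opnorm L.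
Proof.
apply: le_trans (normr_ge0 (L 0)) _; apply: (sup_upper_bound ball_has_sup).
by exists 0 => //=; rewrite normr0.
Qed.

Lemma opnorm_gt0 : (L : H -> G) <> (fun=> 0) -> 0 < opnorm L.
Proof.
move=> L0; rewrite ltNge; apply/negP => opnorm_le0; apply: L0.
apply/funext => x; apply/eqP; rewrite -normr_le0.
by apply: le_trans (opnormP x) _; rewrite mulr_le0_ge0.
Qed.

(** The vector that represents [x |-> '[L x, v]] shows that the choice made in
    [adjoint] is made from a nonempty set. *)
Lemma adjointP x v : '[L x, v] = '[x, adjoint L v].
Proof.
have [||w wP] :=
  @Riesz_representation R H (fun x => '[L x, v]) (opnorm L * `|v|).
- by move=> a y y'; rewrite linearP innerDl innerZl.
- move=> y; apply: le_trans (abs_inner_le _ _) _.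
  by rewrite mulrAC ler_wpM2r ?opnormP.
- have : [set w | forall y, '[L y, v] = '[y, w]] (adjoint L v).
    by apply: (@xgetI _ _ _ w).
  exact.
Qed.

Lemma adjointC x v : '[adjoint L v, x] = '[v, L x].
Proof. by rewrite innerC -adjointP innerC. Qed.

Lemma adjoint_linear : linear (adjoint L).
Proof.
move=> a v w; apply: inner_inj => u.
by rewrite innerDl innerZl !adjointC innerDl innerZl.
Qed.

Lemma adjoint_le v : `|adjoint L v| <= opnorm L * `|v|.
Proof.
have [->|v0] := eqVneq (adjoint L v) 0.
  by rewrite normr0 mulr_ge0// opnorm_ge0.
rewrite -(@ler_pM2l _ `|adjoint L v|) ?normr_gt0// -expr2 -inner_norm.
rewrite -adjointP; apply: le_trans (inner_le _ _) _.
by rewrite mulrCA mulrA ler_wpM2r ?opnormP.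
Qed.

End adjoint.

(** * The primal-dual operator *)

Section primal_dual.
Context (R : realType) (H G : hilbertType R).

Definition op_hsum (M : H -> set H) (N : G -> set G) :
    hsum H G -> set (hsum H G) :=
  fun p => [set u | M (hfst p) (hfst u) /\ N (hsnd p) (hsnd u)].

(** If [(x, u)] fails to be monotonically related to a point of each graph,
    then the two failures add up in the product. *)
Lemma maximally_monotone_hsum M N : maximally_monotone M ->
  maximally_monotone N -> maximally_monotone (op_hsum M N).
Proof.
move=> /maximally_monotoneP[Mmono Mmax] /maximally_monotoneP[Nmono Nmax].
apply/maximally_monotoneP; split.
  move=> x u y v [Mxu Nxu] [Myv Nyv].
  by rewrite hsum_innerE addr_ge0//; [exact: Mmono|exact: Nmono].
move=> x u xu.
have sum_ge0 y v y' v' : M y v -> N y' v' ->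
    0 <= '[hfst x - y, hfst u - v] + '[hsnd x - y', hsnd u - v'].
  by move=> Myv Ny'v'; exact: (xu (hpair y y') (hpair v v')).
have [Mxu|nMxu] := pselect (M (hfst x) (hfst u)).
  split => //; apply: Nmax => y v Nyv.
  by have := sum_ge0 _ _ _ _ Mxu Nyv; rewrite subrr inner0l add0r.
have [y [v [Myv yv_lt0]]] : exists y v, M y v /\ '[hfst x - y, hfst u - v] < 0.
  apply: contrapT => h; apply: nMxu; apply: Mmax => y v Myv.
  by rewrite leNgt; apply/negP => yv; apply: h; exists y, v.
have Nxu : N (hsnd x) (hsnd u).
  apply: Nmax => y' v' Ny'v'.
  by have := sum_ge0 _ _ _ _ Myv Ny'v'; lra.
have := sum_ge0 _ _ _ _ Myv Nxu; rewrite subrr inner0l addr0; lra.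
Qed.

Lemma resolvent_hsum M N c w : 0 < c -> maximally_monotone M ->
  maximally_monotone N -> resolvent (op_scale c (op_hsum M N)) w =
  hpair (resolvent (op_scale c M) (hfst w)) (resolvent (op_scale c N) (hsnd w)).
Proof.
move=> c0 Mmax Nmax; apply: resolvent_unique => //.
  exact: maximally_monotone_hsum.
by split; rewrite !hsumE; exact: resolventP.
Qed.

Lemma abs_summable_hpair (u : nat -> H) (v : nat -> G) :
  abs_summable u -> abs_summable v ->
  cvg (series (fun n => `|hpair (u n) (v n)|) @ \oo).
Proof.
move=> /abs_summable_cvg us /abs_summable_cvg vs.
apply: (@cvg_series_le _ _ (fun n => `|u n| + `|v n|)).
  by move=> n; rewrite normr_ge0 hsum_norm_le.
by rewrite seriesD; exact: is_cvgD.
Qed.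

End primal_dual.

Lemma resolvent_shift (R : realType) (H : hilbertType R) (M : H -> set H)
    (w y : H) (c : R) : 0 < c -> maximally_monotone M ->
  resolvent (op_scale c (op_shift M w)) y =
  resolvent (op_scale c M) (y + c *: w).
Proof.
move=> c0 Mmax; apply: resolvent_unique => //.
  exact: maximally_monotone_shift.
have := resolventP (y + c *: w) c0 Mmax.
rewrite /op_shift /= addrAC scalerDr scalerA mulVf ?gt_eqF//.
by rewrite scale1r.
Qed.

(** * Moduli of uniform monotonicity *)

(** Beyond [d] the modulus is at least [phi d], which is positive; so
    [phi (t n)] cannot be small unless [t n < d]. *)
Lemma modulus_cvg0 (R : realType) (phi : R -> \bar R) (t e : nat -> R) :
  (forall s, 0 <= s -> (0 <= phi s)%E) ->
  (forall s s', 0 <= s -> s <= s' -> (phi s <= phi s')%E) ->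
  (forall s, 0 <= s -> (phi s = 0%E <-> s = 0)) ->
  (forall n, 0 <= t n) -> (forall n, (phi (t n) <= (e n)%:E)%E) ->
  e @ \oo --> (0 : R) -> t @ \oo --> (0 : R).
Proof.
move=> phi0 phi_homo phi_eq0 t0 te e0; apply/cvgrPdist_lt => d d0.
have [r r0 rphi] : exists2 r : R, 0 < r & (r%:E <= phi d)%E.
  have : (0 < phi d)%E.
    rewrite lt_def phi0 ?(ltW d0)// andbT; apply/eqP => /phi_eq0.
    by rewrite (ltW d0) => /(_ isT) d_eq0; rewrite d_eq0 ltxx in d0.
  case: (phi d) => [r|_|]//; first by rewrite lte_fin => r0; exists r.
  by exists 1; rewrite ?leey.
move: e0 => /cvgrPdist_lt /(_ r r0); apply: filterS => n.
rewrite !sub0r !normrN (ger0_norm (t0 n)) => er.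
rewrite ltNge; apply/negP => dt.
have := le_trans rphi (le_trans (phi_homo _ _ (ltW d0) dt) (te n)).
by rewrite lee_fin leNgt (le_lt_trans (ler_norm _) er).
Qed.

Theorem theorem3p1 (R : realType) (H G : hilbertType R)
    (A : H -> set H) (B : G -> set G) (L : {linear H -> G}) (z : H) (r : G)
    (A_max : maximally_monotone A) (B_max : maximally_monotone B)
    (L_bounded : bounded_fun_norm L)
    (L_neq0 : (L : H -> G) <> (fun=> 0))
    (z_ran : op_ran (primal_op A B L r) z)
    (a1 b1 c1 : nat -> H) (a2 b2 c2 : nat -> G)
    (a1_sum : abs_summable a1) (b1_sum : abs_summable b1)
    (c1_sum : abs_summable c1)
    (a2_sum : abs_summable a2) (b2_sum : abs_summable b2)
    (c2_sum : abs_summable c2)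
    (x0 : H) (v0 : G)
    (eps : R) (eps_gt0 : 0 < eps) (eps_lt : eps < 1 / (opnorm L + 1))
    (gamma : nat -> R)
    (gamma_bounds : forall n, eps <= gamma n <= (1 - eps) / opnorm L)
    (x y1 p1 q1 : nat -> H) (v y2 p2 q2 : nat -> G)
    (x_init : x 0%N = x0) (v_init : v 0%N = v0)
    (y1E : forall n, y1 n = x n - gamma n *: (adjoint L (v n) + a1 n))
    (y2E : forall n, y2 n = v n + gamma n *: (L (x n) + a2 n))
    (p1E : forall n, p1 n =
       resolvent (op_scale (gamma n) A) (y1 n + gamma n *: z) + b1 n)
    (p2E : forall n, p2 n =
       resolvent (op_scale (gamma n) (op_inv B)) (y2 n - gamma n *: r) + b2 n)
    (q1E : forall n, q1 n = p1 n - gamma n *: (adjoint L (p2 n) + c1 n))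
    (q2E : forall n, q2 n = p2 n + gamma n *: (L (p1 n) + c2 n))
    (x_next : forall n, x n.+1 = x n - y1 n + q1 n)
    (v_next : forall n, v n.+1 = v n - y2 n + q2 n) :
  exists (xbar : H) (vbar : G),
    [/\ primal_solution A B L z r xbar,
        dual_solution A B L z r vbar,
        A xbar (z - adjoint L vbar) &
        B (L xbar - r) vbar] /\
    [/\
     ((fun n => x n - p1 n) @ \oo --> (0 : H)) /\
     ((fun n => v n - p2 n) @ \oo --> (0 : G)),
     [/\ weak_cvg x xbar, weak_cvg p1 xbar,
         weak_cvg v vbar & weak_cvg p2 vbar],
     uniformly_monotone_at A xbar ->
       (x @ \oo --> xbar) /\ (p1 @ \oo --> xbar) &
     uniformly_monotone_at (op_inv B) vbar ->
       (v @ \oo --> vbar) /\ (p2 @ \oo --> vbar)].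
Proof.
pose S (p : hsum H G) := hpair (adjoint L (hsnd p)) (- L (hfst p)).
have SE p : S p = hpair (adjoint L (hsnd p)) (- L (hfst p)) by [].
pose M := op_hsum (op_shift A z) (op_shift (op_inv B) (- r)).
have Az_max := maximally_monotone_shift z A_max.
have Bi_max := maximally_monotone_inv B_max.
have Br_max := maximally_monotone_shift (- r) Bi_max.
have M_max : maximally_monotone M by exact: maximally_monotone_hsum.
have adjL := adjoint_linear L_bounded.
have S_linear : linear S.
  by move=> a p q; rewrite !SE !hsumE adjL linearP opprD -scalerN.
have S_skew p : '[S p, p] = 0.
  by rewrite hsum_innerE SE !hsumE innerNl adjointC// (innerC (hsnd p)) subrr.
have beta_gt0 := opnorm_gt0 L_bounded L_neq0.
have S_bounded p : `|S p| <= opnorm L * `|p|.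
  have beta_ge0 := ltW beta_gt0.
  rewrite -ler_sqr ?nnegrE ?mulr_ge0// exprMn !hsum_normE mulrDr addrC.
  rewrite -!exprMn SE !hsumE normrN lerD// ler_sqr ?nnegrE ?mulr_ge0//.
    exact: opnormP.
  exact: adjoint_le.
have gamma_gt0 n : 0 < gamma n.
  by have /andP[+ _] := gamma_bounds n; exact: lt_le_trans.
have zeroP p : M p (- S p) <->
    A (hfst p) (z - adjoint L (hsnd p)) /\ B (L (hfst p) - r) (hsnd p).
  have -> : M p (- S p) = (A (hfst p) (hfst (- S p) + z) /\
    B (hsnd (- S p) - r) (hsnd p)) by [].
  by rewrite SE !hsumE opprK addrC.
have Nsum (V : normedModType R) (u : nat -> V) :
    abs_summable u -> abs_summable (fun n => - u n).
  by rewrite /abs_summable; under [in X in _ -> X]eq_eseriesr do rewrite normrN.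
have [] := @Tseng_splitting R (hsum H G) M S (opnorm L) eps gamma M_max S_linear
  S_skew beta_gt0 S_bounded eps_gt0 gamma_bounds
  (fun n => hpair (a1 n) (- a2 n)) (fun n => hpair (b1 n) (b2 n))
  (fun n => hpair (c1 n) (- c2 n)) (fun n => hpair (x n) (v n))
  (fun n => hpair (y1 n) (y2 n)) (fun n => hpair (p1 n) (p2 n))
  (fun n => hpair (q1 n) (q2 n)).
- exact: abs_summable_hpair a1_sum (Nsum _ _ a2_sum).
- exact: abs_summable_hpair.
- exact: abs_summable_hpair c1_sum (Nsum _ _ c2_sum).
- move=> n; apply: hsum_ext; rewrite !SE !hsumE ?y1E//.
  by rewrite y2E -opprD scalerN opprK.
- move=> n; rewrite resolvent_hsum// !hsumE !resolvent_shift// scalerN p1E p2E.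
  by [].
- move=> n; apply: hsum_ext; rewrite !SE !hsumE ?q1E//.
  by rewrite q2E -opprD scalerN opprK.
- by move=> n; rewrite x_next v_next.
- case: z_ran => xs [u Axu [w Bw uw]]; exists (hpair xs w); apply/zeroP.
  by rewrite !hsumE -uw addrK.
move=> l [/zeroP[Al Bl] xl xp [pt [w [ptw xpt ptl]]]].
exists (hfst l), (hsnd l); split.
  split => //.
  - exists (z - adjoint L (hsnd l)) => //; exists (hsnd l) => //.
    by rewrite subrK.
  - exists (hfst l) => //; exists (L (hfst l) - r) => //.
    by rewrite addrA addNr add0r.
have xp1 : (fun n => x n - p1 n) @ \oo --> (0 : H) by exact: (cvg_hfst xp).
have vp2 : (fun n => v n - p2 n) @ \oo --> (0 : G) by exact: (cvg_hsnd xp).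
have xl1 : weak_cvg x (hfst l) by exact: (weak_cvg_hfst xl).
have vl2 : weak_cvg v (hsnd l) by exact: (weak_cvg_hsnd xl).
have [A_mono _] := (maximally_monotoneP A).1 A_max.
have [Bi_mono _] := (maximally_monotoneP (op_inv B)).1 Bi_max.
(* The two monotonicity gaps between [l] and [pt n]; in their sum the terms
   that involve [L] cancel. *)
pose gapA n := '[hfst l - hfst (pt n),
  z - adjoint L (hsnd l) - (hfst (w n - S (pt n)) + z)].
pose gapB n := '[hsnd l - hsnd (pt n),
  L (hfst l) - r - (hsnd (w n - S (pt n)) - r)].
have gapE n : gapA n + gapB n = '[pt n - l, w n].
  rewrite /gapA /gapB hsum_innerE SE !hsumE !innerE -!(adjointP L_bounded).
  by rewrite !(innerC _ (L _)); ring.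
have ptA n : A (hfst (pt n)) (hfst (w n - S (pt n)) + z) by case: (ptw n).
have ptB n : op_inv B (hsnd (pt n)) (hsnd (w n - S (pt n)) - r).
  by case: (ptw n).
have gapA_ge0 n : 0 <= gapA n by exact: A_mono Al (ptA n).
have gapB_ge0 n : 0 <= gapB n by exact: Bi_mono Bl (ptB n).
have cvg_of_gap (V : normedModType R) (f g h : nat -> V) (m : V) :
    (fun n => f n - g n) @ \oo --> (0 : V) ->
    (fun n => f n - h n) @ \oo --> (0 : V) ->
    (fun n => `|m - h n|) @ \oo --> (0 : R) ->
    (f @ \oo --> m) /\ (g @ \oo --> m).
  move=> fg fh /norm_cvg0P hm.
  have fm : f @ \oo --> m.
    rewrite (_ : f = fun n => m - (m - h n) + (f n - h n)); last first.
      by apply/funext => n; rewrite subKr addrC subrK.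
    rewrite -[X in _ --> X]addr0 -[X in _ --> X + _]subr0.
    by apply: cvgD => //; apply: cvgB => //; exact: cvg_cst.
  split=> //; rewrite (_ : g = fun n => f n - (f n - g n)); last first.
    by apply/funext => n; rewrite subKr.
  by rewrite -[X in _ --> X]subr0; exact: cvgB.
split => //.
- split => //; [exact: weak_cvg_bounded_dist xl1 xp1
               |exact: weak_cvg_bounded_dist vl2 vp2].
- move=> [_ [phi [phi0 phi_homo phi_eq0 phiP]]].
  apply: (cvg_of_gap _ _ _ (fun n => hfst (pt n)) _ xp1 (cvg_hfst xpt)).
  apply: (modulus_cvg0 phi0 phi_homo phi_eq0 _ _ ptl) => // n.
  apply: le_trans (phiP _ _ _ Al (ptA n)) _.
  by rewrite lee_fin -gapE lerDl.
- move=> [_ [phi [phi0 phi_homo phi_eq0 phiP]]].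
  apply: (cvg_of_gap _ _ _ (fun n => hsnd (pt n)) _ vp2 (cvg_hsnd xpt)).
  apply: (modulus_cvg0 phi0 phi_homo phi_eq0 _ _ ptl) => // n.
  apply: le_trans (phiP _ _ _ Bl (ptB n)) _.
  by rewrite lee_fin -gapE lerDr.
Qed.
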